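(* Let $\Gamma$ be a countable group. Then for any essentially free, ergodic, probability-measure-preserving action $\Gamma \curvearrowright (X,\mathcal{B},\mu)$ on a standard probability space there exists a $\Gamma$-invariant Borel probability measure $\nu$ on $\mathrm{Ord}(\Gamma)$ such that $\Gamma \curvearrowright (X,\mathcal{B},\mu)$ is measure-theoretically isomorphic to $\Gamma \curvearrowright (\mathrm{Ord}(\Gamma),\nu)$.
   Context: $\mathrm{Ord}(\Gamma)$ is the set of (strict) total orders on the set $\Gamma$, i.e. irreflexive transitive binary relations $\prec$ such that for all $x\ne y$ exactly one of $x \prec y$, $y \prec x$ holds. It is a compact metrizable space as a closed subset of $\{0,1\}^{\Gamma\times\Gamma}$ with the product topology. $\Gamma$ acts on it by homeomorphisms via left multiplication: $x\,(\gamma\cdot\prec)\,y$ if and only if $\gamma^{-1}x \prec \gamma^{-1}y$. An action is essentially free if for $\mu$-almost every $x$ the stabilizer $\{\gamma\in\Gamma:\gamma x = x\}$ is trivial. Measure-theoretic isomorphism means an equivariant measure-preserving bimeasurable bijection between invariant subsets of full measure. *)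

(* Defs.v *)
From HB Require Import structures.
From mathcomp Require Import all_boot all_order all_algebra.
From mathcomp Require Import monoid.
From mathcomp Require Import all_classical all_reals all_analysis.
From mathcomp Require Import wochoice.

Set Implicit Arguments.
Unset Strict Implicit.
Unset Printing Implicit Defensive.

Local Open Scope classical_set_scope.
Local Open Scope group_scope.

(* Standard Borel spaces: measurable spaces isomorphic to a Polish space (a
   complete separable metric space) with its Borel sigma-algebra. *)

#[short(type="completeMetricType")]
HB.structure Definition CompleteMetric (K : numDomainType) :=
  {T of Metric K T & Complete T}.

Definition borelType (T : ptopologicalType) := g_sigma_algebraType (@open T).

HB.instance Definition _ (T : ptopologicalType) := Measurable.on (borelType T).

Definition separable (T : topologicalType) :=
  exists2 D : set T, countable D & dense D.

Definition standard_borel (R : realType) d (T : measurableType d) :=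
  exists (P : completeMetricType R) (f : T -> borelType P)
         (g : borelType P -> T),
    [/\ separable P, cancel f g, cancel g f,
        measurable_fun [set: T] f & measurable_fun [set: borelType P] g].

Section actions.
Variables (R : realType) (G : groupType).

Definition is_action (T : Type) (act : G -> T -> T) :=
  (forall x, act 1 x = x) /\ (forall g h x, act (g * h) x = act g (act h x)).

Definition invariant_set (T : Type) (act : G -> T -> T) (A : set T) :=
  forall g, act g @^-1` A = A.

Definition stabilizer (T : Type) (act : G -> T -> T) (x : T) : set G :=
  [set g | act g x = x].

Section one_action.
Context d (T : measurableType d).
Variables (mu : probability T R) (act : G -> T -> T).

Definition measurable_action := forall g, measurable_fun [set: T] (act g).

Definition invariant_measure :=
  forall g A, measurable A -> mu (act g @^-1` A) = mu A.

Definition essentially_free := {ae mu, forall x, stabilizer act x = [set 1]}.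

Definition ergodic :=
  forall A, measurable A -> invariant_set act A -> mu A = 0%E \/ mu A = 1%E.

Definition invariant_conull (A : set T) :=
  [/\ measurable A, invariant_set act A & mu A = 1%E].

End one_action.

(* [f] need only be meaningful on [A]; totality is harmless since measurable
   spaces are pointed. *)
Definition isomorphic_actions
    d1 (T1 : measurableType d1) (mu1 : probability T1 R) (act1 : G -> T1 -> T1)
    d2 (T2 : measurableType d2) (mu2 : probability T2 R) (act2 : G -> T2 -> T2) :=
  exists (A : set T1) (B : set T2) (f : T1 -> T2),
    [/\ invariant_conull mu1 act1 A /\ invariant_conull mu2 act2 B,
        set_bij A B f,
        measurable_fun A f /\
          (forall C, measurable C -> C `<=` A -> measurable (f @` C)),
        forall g x, A x -> f (act1 g x) = act2 g (f x) &
        forall D, measurable D -> mu1 (A `&` f @^-1` D) = mu2 D].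

End actions.

Section Ord.
Variable G : groupType.

Definition strict_total_orders : set {ptws (G * G) -> bool} :=
  [set r | [/\ forall x, ~~ r (x, x),
               forall x y z, r (x, y) -> r (y, z) -> r (x, z) &
               forall x y, x != y -> r (x, y) (+) r (y, x)]].

(* As a [set_type], [Ord] carries the subspace topology of the product topology
   on [G * G -> bool]. *)
Definition Ord : Type := strict_total_orders.

HB.instance Definition _ := Topological.on Ord.

Definition ord_rel (o : Ord) (x y : G) : bool := set_val o (x, y).

Lemma strict_total_orders_nonempty : exists r, r \in strict_total_orders.
Proof.
have [R Rwo] := well_ordering_principle G.
have Rwo' : wo_chain R predT by move=> A _; apply: Rwo.
have tR x y : R x y || R y x by apply: (wo_chainW Rwo').
have aR x y : R x y -> R y x -> x = y.
  by move=> xy yx; apply: (wo_chain_antisymmetric Rwo'); rewrite ?xy.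
exists (fun p => R p.1 p.2 && (p.1 != p.2)); rewrite inE; split=> /=.
- by move=> x; rewrite eqxx andbF.
- move=> x y z /andP[xy /eqP nxy] /andP[yz /eqP nyz].
  have [|m [[+ lb] _]] := Rwo [mem [:: x; y; z]].
    by exists x; rewrite inE eqxx.
  have [mx my mz] : [/\ R m x, R m y & R m z].
    by split; apply: lb; rewrite !inE eqxx ?orbT.
  rewrite !inE => /or3P[] /eqP E; subst m.
  + by rewrite mz; apply/eqP => xz; apply: nxy; apply: aR; rewrite // xz.
  + by case: nxy; apply: aR.
  + by case: nyz; apply: aR.
- move=> x y nxy; rewrite (eq_sym y) nxy !andbT.
  case xy: (R x y) (tR x y); case yx: (R y x) => //= _.
  by rewrite (aR x y) ?eqxx in nxy.
Qed.

HB.instance Definition _ := isPointed.Build Ord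
  (exist _ _ (svalP (cid strict_total_orders_nonempty)) : Ord).

Lemma translate_subproof (g : G) (o : Ord) :
  ((fun p => ord_rel o (g^-1 * p.1) (g^-1 * p.2)) : {ptws (G * G) -> bool})
    \in strict_total_orders.
Proof.
have /set_mem[irr tr tot] := valP o; rewrite inE; split=> /=.
- by move=> x; apply: irr.
- by move=> x y z; apply: tr.
- by move=> x y nxy; apply: tot; rewrite (inj_eq (mulgI _)).
Qed.

Definition ord_act (g : G) (o : Ord) : Ord :=
  exist (fun r => r \in strict_total_orders) _ (translate_subproof g o).

Lemma ord_actE g o x y :
  ord_rel (ord_act g o) x y = ord_rel o (g^-1 * x) (g^-1 * y).
Proof. by []. Qed.

End Ord.

(* Main.v *)
Require Import Defs.
From HB Require Import structures.
From mathcomp Require Import all_boot all_order all_algebra.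
From mathcomp Require Import monoid.
From mathcomp Require Import all_classical all_reals all_analysis.

(** A point [x] is sent to the order on [Gamma] in which [g] precedes [h] when
    [act g^-1 x] precedes [act h^-1 x] in a fixed measurable strict total order
    on [X]. This map [Phi] is equivariant, and its values are total orders where
    the action is free ([orbit_order_map]). The pushforward of [mu] under [Phi]
    is the required measure as soon as [x] can be recovered measurably from
    [Phi x] on an invariant conull set: the image of that set is then the
    measurable set of fixed points of [Phi \o Psi], where [Psi] is the recovery
    map, so that no theorem on injective images of Borel sets is called upon
    ([isomorphism_of_equivariant_retract]). To recover [x] it suffices to read
    off from [Phi x] whether [x] lies in each set of one suitable countable
    family, since the target is complete ([standard_borel_decode]). Call a set
    readable when membership of [x] in it is a measurable condition on [Phi x].
    Readable sets form a sigma-algebra stable under translation that contains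
    every set of the form [act g x] precedes [act h x]. Everything thus depends
    on choosing the order on [X] so that enough sets are readable.

    If some set of positive measure cannot be split into two sets of positive
    measure, the measure has an atom, and [mu] is carried by its orbit. A
    translation then has finite order, because the translates of the atom all
    have the same mass, whereas an element of finite order that fixes a total
    order is trivial. So [Phi] is injective on a countable conull set for any
    choice of the order, and every subset of it is readable.

    Otherwise there are a group element [g], a set [B] of positive measure that
    is disjoint from its translate by [g], and a sequence of disjoint subsets of
    [B] of positive measure. By ergodicity almost every orbit meets each of
    these subsets. This allows membership in the countable family to be
    encoded, at the points where the orbit visits [B], by countably many disjoint
    pieces [Q l] of [B] ([countable_generator]). Writing [g Q] for the translate
    of [Q] by [g], the order on [X] is chosen with consecutive blocks
<<
      g (Q 0) < Q 0 < g (Q 1) < Q 1 < ... < all other points.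
>>
    Once the blocks before [g (Q l)] are readable, so is [g (Q l)]: among the
    points outside these blocks, its elements are those that have no point [z]
    of their orbit at or below them such that [act g z] also lies outside and
    precedes [z] ([block_evenE]). Hence all pieces are readable by induction
    ([readable_block]), and so is the countable family. *)

Set Implicit Arguments.
Unset Strict Implicit.
Unset Printing Implicit Defensive.

Import Order.TTheory GRing.Theory Num.Theory.
Local Open Scope classical_set_scope.

(** * Measurable predicates *)

Section measurable_predicates.
Context d (T : measurableType d).

Lemma measurable_pred_not (P : T -> Prop) :
  measurable [set x | P x] -> measurable [set x | ~ P x].
Proof. exact: measurableC. Qed.

Lemma measurable_pred_and (P Q : T -> Prop) :
  measurable [set x | P x] -> measurable [set x | Q x] ->
  measurable [set x | P x /\ Q x].
Proof. exact: measurableI. Qed.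

Lemma measurable_pred_or (P Q : T -> Prop) :
  measurable [set x | P x] -> measurable [set x | Q x] ->
  measurable [set x | P x \/ Q x].
Proof. exact: measurableU. Qed.

Lemma measurable_pred_cst (P : Prop) : measurable [set x : T | P].
Proof.
have [p|np] := pselect P.
- by rewrite (_ : mkset _ = setT)//; apply/seteqP; split.
- by rewrite (_ : mkset _ = set0)//; apply/seteqP; split.
Qed.

Lemma measurable_pred_exists I (P : I -> T -> Prop) : countable [set: I] ->
  (forall i, measurable [set x | P i x]) ->
  measurable [set x | exists i, P i x].
Proof.
move=> cI mP; rewrite (_ : mkset _ = \bigcup_i [set x | P i x]).
  exact: countable_bigcupT_measurable.
by apply/seteqP; split=> x /= [i]; [exists i|move=> _; exists i].
Qed.

Lemma measurable_pred_forall I (P : I -> T -> Prop) : countable [set: I] ->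
  (forall i, measurable [set x | P i x]) ->
  measurable [set x | forall i, P i x].
Proof.
move=> cI mP.
rewrite (_ : mkset _ = ~` [set x | exists i, ~ P i x]).
  apply/measurableC/measurable_pred_exists => // i.
  exact/measurable_pred_not.
apply/seteqP; split=> x /=; first by move=> Px [i]; apply.
by move=> /forallNP Px i; apply: contrapT (Px i).
Qed.

Lemma measurable_preimageT d' (U : measurableType d') (f : T -> U) A :
  measurable_fun setT f -> measurable A -> measurable (f @^-1` A).
Proof. by move=> mf mA; rewrite -[_ @^-1` _]setTI; apply: mf. Qed.

End measurable_predicates.

Lemma countable_inj T (U : countType) (f : T -> U) :
  injective f -> countable [set: T].
Proof.
move=> f_inj; apply/countable_injP; exists (pickle \o f).
by apply: in2W; apply: inj_comp => //; exact: (pcan_inj pickleK).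
Qed.

(** * The Borel structure of the space of orders *)

(** The sets that contain a cylinder around [f] form a filter, which converges to
    [f] because it does so in every coordinate. *)
Lemma open_prod_cylinder (I : eqType) (K : I -> topologicalType)
    (V : set (prod_topology K)) (f : prod_topology K) : open V -> V f ->
  exists s : seq I, forall g : prod_topology K,
    (forall i, i \in s -> g i = f i) -> V g.
Proof.
move=> oV Vf.
pose F : set_system (prod_topology K) := [set A | exists s : seq I,
  forall g : prod_topology K, (forall i, i \in s -> g i = f i) -> A g].
have FF : Filter F.
  split.
  - by exists [::].
  - move=> A B [s sA] [t tB]; exists (s ++ t) => g gst; split.
    + by apply: sA => i si; apply: gst; rewrite mem_cat si.
    + by apply: tB => i si; apply: gst; rewrite mem_cat si orbT.
  - by move=> A B AB [s sA]; exists s => g /sA /AB.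
have : F --> f.
  apply/cvg_sup => i A.
  rewrite (@nbhsE (initial_topology (fun h : forall i, K i => h i))).
  move=> -[_ [[W oW <-] Wf] sub].
  by exists [:: i] => g gi; apply: sub => /=; rewrite gi ?mem_head.
by apply; apply: open_nbhs_nbhs.
Qed.

Section ord_borel.
Variable G : groupType.
Hypothesis G_countable : countable [set: G].

Lemma measurable_ord_rel (x y : G) :
  measurable [set o : borelType (Ord G) | ord_rel o x y].
Proof.
apply: sub_sigma_algebra.
exists [set r : {ptws (G * G) -> bool} | r (x, y)]; last first.
  by apply/seteqP; split.
rewrite (_ : mkset _ = (fun r : {ptws (G * G) -> bool} => r (x, y)) @^-1` [set true]).
  apply: open_comp; last exact: discrete_open.
  move=> r _; apply: (@proj_continuous _ (fun _ => bool) (x, y)).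
by apply/seteqP; split.
Qed.

Lemma ord_ext (o o' : Ord G) :
  (forall x y, ord_rel o x y = ord_rel o' x y) -> o = o'.
Proof.
by move=> oo'; apply: val_inj; apply/funext => -[x y]; apply: oo'.
Qed.

(** Countability of [G] makes the Borel sigma-algebra the one generated by
    cylinders: an open set is the union of the cylinders inside it, and there are
    only countably many finite patterns. *)
Lemma measurable_fun_ord d (T : measurableType d) (D : set T)
    (f : T -> borelType (Ord G)) : measurable D ->
  (forall x y, measurable (D `&` [set t | ord_rel (f t) x y])) ->
  measurable_fun D f.
Proof.
move=> mD mf.
refine (@measurability _ _ T (borelType (Ord G)) D f (@open (Ord G)) erefl _).
move=> _ [U [V oV <-] <-].
pose agree (s : seq ((G * G) * bool)) (o : Ord G) :=
  forall pb, pb \in s -> ord_rel o pb.1.1 pb.1.2 = pb.2.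
pose Us s := forall o : Ord G, agree s o -> V (set_val o).
rewrite (_ : _ `&` _ = \bigcup_s [set t | D t /\ (agree s (f t) /\ Us s)]).
  apply: countable_bigcupT_measurable => [|s].
    move: G_countable => /countable_injP[i /in2TT i_inj].
    pose j := fun p : (G * G) * bool => ((i p.1.1, i p.1.2), p.2).
    have /inj_map j_inj : injective j.
      by move=> [[? ?] ?] [[? ?] ?] [/i_inj -> /i_inj -> ->].
    exact: countable_inj j_inj.
  rewrite /agree; elim: s (Us s) => [|[[x y] b] s IH] P.
    apply: measurable_pred_and => //.
    rewrite (_ : mkset _ = [set t | P]); first exact: measurable_pred_cst.
    by apply/seteqP; split => t /=; [case|].
  pose E := [set t | D t /\ ord_rel (f t) x y = b].
  rewrite (_ : mkset _ = E `&` [set t | D t /\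
     ((forall pb, pb \in s -> ord_rel (f t) pb.1.1 pb.1.2 = pb.2) /\ P)]).
    apply: measurableI; last exact: IH.
    case: b @E => /=; first exact: mf.
    rewrite (_ : mkset _ = D `\` (D `&` [set t | ord_rel (f t) x y])).
      by apply: measurableD.
    apply/seteqP; split => t /= [Dt xy]; split => //; first by rewrite xy => -[].
    by apply/negbTE/negP => ?; apply: xy.
  apply/seteqP; split => t /=.
    move=> [Dt [st Pt]]; split.
      by split=> //; exact: (st (x, y, b) (mem_head _ _)).
    by do !split=> //; move=> pb pbs; apply: st; rewrite in_cons pbs orbT.
  move=> [[_ xy] [Dt [st Pt]]]; do !split=> //; move=> pb; rewrite in_cons.
  by move=> /orP[/eqP->|/st].
apply/seteqP; split=> t /=.
  move=> [Dt Vt].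
  have [s sV] := open_prod_cylinder oV Vt.
  exists [seq (p, ord_rel (f t) p.1 p.2) | p <- s] => //=.
  split=> //; split; first by move=> pb /mapP[p _ ->].
  move=> o ao; apply: sV => -[x y] xys.
  by apply: (ao (x, y, ord_rel (f t) x y)); apply/mapP; exists (x, y).
by move=> [s _ [Dt [sa Us_s]]]; split=> //; apply: Us_s.
Qed.

Lemma measurable_ord_act (g : G) :
  measurable_fun setT (ord_act g : borelType (Ord G) -> borelType (Ord G)).
Proof.
apply: measurable_fun_ord => // x y; rewrite setTI.
exact: (measurable_ord_rel (g^-1 * x)%g (g^-1 * y)%g).
Qed.

Lemma ord_actM (g h : G) (o : Ord G) :
  ord_act (g * h)%g o = ord_act g (ord_act h o).
Proof. by apply: ord_ext => x y; rewrite !ord_actE invgM !mulgA. Qed.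

Lemma measurable_ord_eq d (T : measurableType d)
    (f g : T -> borelType (Ord G)) :
  measurable_fun setT f -> measurable_fun setT g ->
  measurable [set t | f t = g t].
Proof.
move=> mf mg; rewrite (_ : mkset _ =
    [set t | forall x y, ord_rel (f t) x y <-> ord_rel (g t) x y]).
  have mr (h : T -> borelType (Ord G)) x y : measurable_fun setT h ->
      measurable [set t | ord_rel (h t) x y].
    by move=> mh; exact: (measurable_preimageT mh (measurable_ord_rel x y)).
  apply: measurable_pred_forall => // x; apply: measurable_pred_forall => // y.
  rewrite (_ : mkset _ = [set t | ord_rel (f t) x y /\ ord_rel (g t) x y \/
     ~ ord_rel (f t) x y /\ ~ ord_rel (g t) x y]).
    apply: measurable_pred_or; apply: measurable_pred_and; try exact: mr;
      apply: measurable_pred_not; exact: mr.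
  apply/seteqP; split => t /=.
    case: (ord_rel (f t) x y) => fg; first by left; split=> //; apply/fg.
    by right; split=> // /fg.
  by case=> -[? ?]; split.
apply/seteqP; split => t /=; first by move=> ->.
by move=> fg; apply: ord_ext => x y; apply/idP/idP => /fg.
Qed.

Lemma measurable_ord1 (o : borelType (Ord G)) : measurable [set o].
Proof.
rewrite (_ : [set o] = [set t : borelType (Ord G) | t = o]) //.
by apply: measurable_ord_eq; [exact: measurable_id|exact: measurable_cst].
Qed.

End ord_borel.

(** * Decoding points of a standard Borel space *)

(** Zero is a junk value for predicates that hold nowhere. *)
Definition first_index (P : nat -> Prop) : nat :=
  if pselect (exists n, `[< P n >]) is left ex then ex_minn ex else 0.

Lemma first_indexP (P : nat -> Prop) n : P n -> P (first_index P).
Proof.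
move=> Pn; rewrite /first_index; case: pselect => [ex|[]]; last first.
  by exists n; apply/asboolP.
by case: ex_minnP => m /asboolP.
Qed.

Lemma measurable_first_index (A : nat -> Prop) d (T : measurableType d)
    (P : nat -> T -> Prop) : (forall n, measurable [set x | P n x]) ->
  measurable [set x | A (first_index (P^~ x))].
Proof.
move=> mP.
rewrite (_ : mkset _ = [set x | exists n,
    (P n x /\ forall m, m < n -> ~ P m x) /\ A n \/
    (forall m, ~ P m x) /\ A 0]).
  apply: measurable_pred_exists => // n; apply: measurable_pred_or.
    apply: measurable_pred_and; last exact: measurable_pred_cst.
    apply: measurable_pred_and => //; apply: measurable_pred_forall => // m.
    case: (m < n); last by rewrite (_ : mkset _ = setT) //; apply/seteqP; split.
    rewrite (_ : mkset _ = [set x | ~ P m x]); first exact: measurable_pred_not.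
    by apply/seteqP; split => x /= H; [exact: H|].
  apply: measurable_pred_and; last exact: measurable_pred_cst.
  by apply: measurable_pred_forall => // m; exact: measurable_pred_not.
apply/seteqP; split=> x /=.
  rewrite /first_index; case: pselect => [ex|nex Ax].
    case: ex_minnP => m /asboolP Pm m_min Am; exists m; left; do !split=> //.
    by move=> i im /asboolP /m_min; rewrite leqNgt im.
  by exists 0; right; split=> // m Pm; apply: nex; exists m; apply/asboolP.
rewrite /first_index => -[n [[[Pn n_min] An]|[nP A0]]]; case: pselect => //.
- move=> ex; case: ex_minnP => m /asboolP Pm m_min.
  suff -> : m = n by [].
  apply/eqP; rewrite eqn_leq; apply/andP; split; first exact/m_min/asboolP.
  by rewrite leqNgt; apply/negP => /n_min; apply.
- by case; exists n; apply/asboolP.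
- by move=> ex; exfalso; case: (ex) => m /asboolP Pm; case: (nP m).
Qed.

Section decode.
Variables (R : realType) (P : completeMetricType R) (D : nat -> P).
Hypothesis D_dense : dense (range D).
Local Open Scope ring_scope.

Let rad (k : nat) : R := k.+1%:R^-1.

Let rad_gt0 k : 0 < rad k. Proof. by rewrite invr_gt0. Qed.

Let rad_small (e : R) : 0 < e -> \forall k \near \oo, rad k < e.
Proof. by move=> e0; exact: (near_infty_natSinv_lt (PosNum e0)). Qed.

(* Interiors are open by the pseudometric axioms alone. *)
Let U (j k : nat) : set P := (ball (D j) (rad k))°.

Let U_cover k x : exists j, U j k x.
Proof.
have e0 : 0 < rad k / 2 by rewrite divr_gt0.
have [||y [/interior_subset yx [j _ Dj]]] := @D_dense (ball x (rad k / 2))°.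
- by exists x; exact: nbhsx_ballx.
- exact: open_interior.
exists j; rewrite /U/= /interior/=; apply: filterS (nbhsx_ballx x _ e0) => z xz.
rewrite Dj; rewrite (splitr (rad k)); apply: ball_triangle xz.
exact: ball_sym.
Qed.

Section decode_map.
Context d (Y : measurableType d) (C : nat -> nat -> set Y).
Hypothesis mC : forall j k, measurable (C j k).

Let s (k : nat) (o : Y) : P := D (first_index (fun j => C j k o)).

Let measurable_s (A : P -> Prop) k : measurable [set o | A (s k o)].
Proof.
by apply: (measurable_first_index (fun j => A (D j))) => j; exact: mC.
Qed.

Let measurable_s2 (A : P -> P -> Prop) k l :
  measurable [set o | A (s k o) (s l o)].
Proof.
rewrite (_ : mkset _ = [set o | exists j, s k o = D j /\ A (D j) (s l o)]).
  apply: measurable_pred_exists => // j.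
  apply: measurable_pred_and; first exact: (measurable_s (fun x => x = D j)).
  exact: (measurable_s (A (D j))).
apply/seteqP; split=> o /=; last by move=> [j [-> ]].
by move=> As; exists (first_index (fun j => C j k o)).
Qed.

Let conv : set Y := [set o | cvg (s ^~ o @ \oo)].

Let convE : conv = [set o | forall l, exists N, forall n, (N <= n)%N ->
  ball (s N o) (rad l) (s n o)].
Proof.
apply/seteqP; split=> o /=.
  move=> co l.
  have e0 : 0 < rad l / 2 by rewrite divr_gt0.
  have [N _ NP] := cvg_ball co e0.
  exists N => n Nn; rewrite (splitr (rad l)).
  apply: (ball_triangle (ball_sym (NP N (leqnn N)))).
  exact: NP.
move=> cau; apply: cauchy_cvg; apply: cauchy_exP => e e0.
have [l _ /(_ l (leqnn l)) le] := rad_small e0.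
have [N NP] := cau l.
exists (s N o); exists N => // n /= Nn; apply: le_ball (NP n Nn).
exact: ltW.
Qed.

Let measurable_conv : measurable conv.
Proof.
rewrite convE; apply: measurable_pred_forall => // l.
apply: measurable_pred_exists => // N; apply: measurable_pred_forall => // n.
exact: (measurable_s2 (fun x y => (N <= n)%N -> ball x (rad l) y)).
Qed.

Let measurable_lim (V : set P) : open V ->
  measurable [set o | conv o /\ V (lim (s ^~ o @ \oo))].
Proof.
move=> oV.
rewrite (_ : mkset _ = [set o | conv o /\ exists l N, forall n, (N <= n)%N ->
    ball (s n o) (rad l) `<=` V]).
  apply: measurable_pred_and => //; apply: measurable_pred_exists => // l.
  apply: measurable_pred_exists => // N; apply: measurable_pred_forall => // n.
  exact: (measurable_s (fun x => (N <= n)%N -> ball x (rad l) `<=` V)).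
apply/seteqP; split=> o /= [co]; set x := lim _.
  move=> Vx.
  have /nbhs_ballP[e /= e0 eV] : nbhs x V by exact: open_nbhs_nbhs.
  have e20 : 0 < e / 2 by rewrite divr_gt0.
  have [l _ /(_ l (leqnn l)) le] := rad_small e20.
  have [N _ NP] := cvg_ball co e20.
  split=> //; exists l, N => n Nn y sy; apply: eV.
  rewrite (splitr e); apply: (ball_triangle (NP n Nn)).
  by apply: le_ball sy; exact: ltW.
move=> [l [N lN]]; split=> //.
have [M _ MP] := cvg_ball co (rad_gt0 l).
apply: (lN (maxn N M)); first exact: leq_maxl.
apply: ball_sym; apply: MP; exact: leq_maxr.
Qed.

Let Psi (o : Y) : borelType P :=
  if pselect (conv o) then lim (s ^~ o @ \oo) else point.

(** The point is the limit of the centres of the first balls that [o] selects at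
    each scale. The approximants take countably many values, which is what makes
    the convergence set and the limit measurable. *)
Lemma decode_complete : exists2 Psi : Y -> borelType P,
  measurable_fun setT Psi & forall o x,
    (forall j k, C j k o <-> (ball (D j) (k.+1%:R^-1))° x) -> Psi o = x.
Proof.
exists Psi.
  refine (@measurability _ _ _ (borelType P) setT _ (@open P) erefl _).
  move=> _ [V oV <-]; rewrite setTI.
  rewrite (_ : _ @^-1` _ = [set o | (conv o /\ V (lim (s ^~ o @ \oo))) \/
      (~ conv o /\ V point)]).
    apply: measurable_pred_or; first exact: measurable_lim.
    apply: measurable_pred_and; first exact: measurable_pred_not.
    exact: measurable_pred_cst.
  apply/seteqP; split=> o /=; rewrite /Psi; case: pselect => // co /=.
  - by left.
  - by right.
  - by case=> -[].
  - by case=> -[].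
move=> o x Cx.
have sx : s ^~ o @ \oo --> x.
  apply/cvg_ballP => e e0.
  apply: filterS (rad_small e0) => k ke.
  have [j Ujx] := U_cover k x.
  apply: (le_ball (ltW ke)); apply: ball_sym; apply: interior_subset.
  apply/(Cx (first_index (fun j => C j k o)) k).
  exact/(@first_indexP (fun j => C j k o) j)/Cx.
have co : conv o by exact: cvgP sx.
rewrite /Psi; case: pselect => //= _.
exact: (cvg_lim (@metric_hausdorff _ P) sx).
Qed.

End decode_map.
End decode.

(** Measurability of the recovery map on all of [Y], not just on the range of
    [Phi], is what lets fixed points of [Phi \o Psi] stand in for
    the Lusin-Souslin theorem. *)
Lemma standard_borel_decode (R : realType) d (X : measurableType d) :
  standard_borel R X ->
  exists E : nat -> set X, [/\ forall n, measurable (E n),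
    forall x y, (forall n, E n x <-> E n y) -> x = y &
    forall d' (Y : measurableType d') (X0 : set X) (Phi : X -> Y),
      (forall n, exists2 C, measurable C & forall x, X0 x -> E n x <-> C (Phi x)) ->
      exists2 Psi : Y -> X, measurable_fun setT Psi &
        forall x, X0 x -> Psi (Phi x) = x].
Proof.
move=> [P [f [g [[D0 cD0 dD0] fK gK mf mg]]]].
have [D D_dense] : exists D : nat -> P, dense (range D).
  have [x D0x] : D0 !=set0.
    have [|y [_ ?]] := dD0 setT _ openT; first by exists point.
    by exists y.
  move: cD0 => /countable_injP[i i_inj].
  exists (fun n => xget x [set y | D0 y /\ i y = n]) => V V0 oV.
  have [y [Vy D0y]] := dD0 V V0 oV.
  exists y; split=> //; exists (i y) => //.
  case: xgetP => [z _ [D0z /i_inj ->]//|/(_ y)/= []//]; exact: mem_set.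
pose B j k : set P := (ball (D j) (k.+1%:R^-1 : R)%R)°.
pose E n : set X := if unpickle n is Some jk then f @^-1` (B jk.1 jk.2) else set0.
suff [mE dec] : (forall n, measurable (E n)) /\ forall d' (Y : measurableType d')
    (X0 : set X) (Phi : X -> Y),
    (forall n, exists2 C, measurable C & forall x, X0 x -> E n x <-> C (Phi x)) ->
    exists2 Psi : Y -> X, measurable_fun setT Psi &
      forall x, X0 x -> Psi (Phi x) = x.
  (* Decoding from a constant map: two inseparable points have the same code. *)
  exists E; split=> // x y xy.
  have [|Psi _ PsiE] := dec _ X [set z | z = x \/ z = y] (cst x).
    by move=> n; exists (E n) => // z /= [->|->]//; rewrite xy.
  by rewrite -(PsiE x (or_introl erefl)) -(PsiE y (or_intror erefl)).
split.
  move=> n; rewrite /E; case: unpickle => // -[j k].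
  apply: (measurable_preimageT mf).
  by apply: sub_sigma_algebra; exact: open_interior.
move=> d' Y X0 Phi EC.
have {EC} [C mC CE] := all_sig2 (fun n => cid2 (EC n)).
have [Psi mPsi PsiE] := decode_complete D_dense (fun j k => mC (pickle (j, k))).
exists (g \o Psi); first exact: measurableT_comp.
move=> x X0x /=; rewrite (PsiE _ (f x)) ?fK// => j k.
by rewrite -CE// /E pickleK.
Qed.

(** * Actions *)

Section action_basics.
Variables (G : groupType) (T : Type) (act : G -> T -> T).
Hypothesis actP : is_action act.

Lemma act1 x : act 1%g x = x. Proof. by case: actP. Qed.

Lemma actM g h x : act (g * h)%g x = act g (act h x).
Proof. by case: actP. Qed.

Lemma actK g x : act g^-1%g (act g x) = x.
Proof. by rewrite -actM mulVg act1. Qed.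

Lemma actVK g x : act g (act g^-1%g x) = x.
Proof. by rewrite -actM mulgV act1. Qed.

Lemma invariant_act (A : set T) g x : invariant_set act A ->
  A (act g x) <-> A x.
Proof. by move=> iA; rewrite -{2}(iA g). Qed.

End action_basics.

(** * Recovering points from orders gives an isomorphism *)

Section isomorphism_criterion.
Variables (R : realType) (G : groupType).
Hypothesis G_countable : countable [set: G].
Context d (X : measurableType d) (mu : probability X R) (act : G -> X -> X).
Hypothesis act_measurable : measurable_action act.
Hypothesis act_pmp : invariant_measure mu act.

(** The image of [X0] is the set of orders [o] with [Psi o] in [X0] and
    [Phi (Psi o) = o]; it is measurable because the diagonal of the space of
    orders is, and images of measurable sets are handled in the same way. *)
Lemma isomorphism_of_equivariant_retract (X0 : set X)
    (Phi : X -> borelType (Ord G)) (Psi : borelType (Ord G) -> X) :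
  invariant_conull mu act X0 ->
  measurable_fun setT Phi -> measurable_fun setT Psi ->
  (forall g x, X0 x -> Phi (act g x) = ord_act g (Phi x)) ->
  (forall x, X0 x -> Psi (Phi x) = x) ->
  exists nu : probability (borelType (Ord G)) R,
    invariant_measure nu (@ord_act G) /\
    isomorphic_actions mu act nu (@ord_act G).
Proof.
move=> [mX0 iX0 mu1] mPhi mPsi PhiE PsiK.
have mPre D : measurable D -> measurable (Phi @^-1` D).
  exact: measurable_preimageT.
have muX0 D : measurable D -> mu (X0 `&` D) = mu D.
  move=> mD; have mu0 : mu (~` X0) = 0%E.
    by rewrite probability_setC// mu1 subee.
  have mN : measurable (D `&` ~` X0).
    by apply: measurableI => //; exact: measurableC.
  have N0 : mu (D `&` ~` X0) = 0%E.
    apply/eqP; rewrite -measure_le0 -mu0 le_measure ?inE//.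
    exact: measurableC.
  have dis : (X0 `&` D) `&` (D `&` ~` X0) = set0.
    by rewrite setIA setIC !setIA setICl !set0I.
  have mU := measureU mu (measurableI _ _ mX0 mD) mN dis.
  rewrite -[RHS](_ : mu ((X0 `&` D) `|` (D `&` ~` X0)) = _).
    by rewrite mU [X in (_ + X)%E]N0 adde0.
  by rewrite (setIC X0) -setIUr setUv setIT.
pose Phi' : {mfun X >-> borelType (Ord G)} :=
  HB.pack Phi (isMeasurableFun.Build _ _ _ _ Phi mPhi).
pose nu : probability (borelType (Ord G)) R := distribution mu Phi'.
have nuE D : nu D = mu (Phi @^-1` D) by [].
pose B := [set o | X0 (Psi o) /\ Phi (Psi o) = o].
have BE : B = Phi @` X0.
  apply/seteqP; split => [p [X0o oE]|_ [x X0x <-]]; first by exists (Psi p).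
  by rewrite /B/= PsiK.
have mB : measurable B.
  apply: measurable_pred_and; first exact: measurable_preimageT.
  by apply: measurable_ord_eq => //; exact: measurableT_comp.
have nu_inv : invariant_measure nu (@ord_act G).
  move=> g D mD; rewrite !nuE -(act_pmp g (mPre _ mD)).
  have mgD : measurable (ord_act g @^-1` D : set (borelType (Ord G))).
    exact: (measurable_preimageT (measurable_ord_act G_countable g) mD).
  rewrite -[LHS]muX0; last exact: mPre.
  rewrite -[RHS]muX0; last exact/(measurable_preimageT (act_measurable g))/mPre.
  by congr (mu _); apply/seteqP; split=> x [X0x] /=; rewrite PhiE.
exists nu; split=> //; exists X0, B, Phi; split.
- split; first by split.
  split=> //.
  + move=> g; rewrite BE; apply/seteqP; split => o /=.
      move=> [x X0x] /(congr1 (ord_act g^-1%g)).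
      rewrite -ord_actM mulVg -PhiE// => xo.
      exists (act g^-1%g x); first by apply/(invariant_act g^-1%g x iX0).
      by rewrite xo; apply: ord_ext => y z; rewrite ord_actE invg1 !mul1g.
    move=> [x X0x <-]; exists (act g x); rewrite ?PhiE//.
    exact/(invariant_act g x iX0).
  + apply/eqP; rewrite eq_le probability_le1//= -mu1 nuE BE.
    rewrite le_measure ?inE//; first by rewrite -BE; exact: mPre.
    by move=> x X0x; exists x.
- split.
  + by move=> x X0x; rewrite BE; exists x.
  + by move=> x y /set_mem X0x /set_mem X0y xy; rewrite -(PsiK x)// xy PsiK.
  + by rewrite BE.
- split; first exact: measurable_funTS.
  move=> C mC CX0; rewrite (_ : _ @` _ = B `&` Psi @^-1` C).
    by apply: measurableI => //; exact: measurable_preimageT.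
  apply/seteqP; split => [_ [x Cx <-]|o [[X0o oo] Co]].
    by rewrite BE/= PsiK; [split => //; exists x; [exact: CX0|]|exact: CX0].
  by exists (Psi o).
- by [].
- by move=> D mD; rewrite muX0 //; exact: mPre.
Qed.

End isomorphism_criterion.

(** * Orders induced on orbits *)

Section lexicographic_order.
Variables (X : Type) (S : nat -> X -> nat).

(** Digits are natural numbers rather than bits so that the position of a block
    can serve as a single digit. *)
Definition lex_lt x y :=
  exists n, (forall m, m < n -> S m x = S m y) /\ S n x < S n y.

Lemma lex_irr x : ~ lex_lt x x.
Proof. by move=> [n [_]]; rewrite ltnn. Qed.

Lemma lex_trans y x z : lex_lt x y -> lex_lt y z -> lex_lt x z.
Proof.
move=> [n [xyE xy]] [m [yzE yz]]; have [nm|mn|E] := ltngtP n m.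
- exists n; rewrite -(yzE _ nm); split=> // k kn.
  by rewrite xyE// yzE// (ltn_trans kn).
- exists m; rewrite (xyE _ mn); split=> // k km.
  by rewrite -yzE// xyE// (ltn_trans km).
- rewrite -{}E in yz yzE; exists n; split; last exact: ltn_trans yz.
  by move=> k kn; rewrite xyE ?yzE.
Qed.

Hypothesis S_sep : forall x y, (forall n, S n x = S n y) -> x = y.

Lemma lex_total x y : x <> y -> lex_lt x y \/ lex_lt y x.
Proof.
move=> xy; have ex : exists n, S n x != S n y.
  apply: contrapT => nex; apply/xy/S_sep => n.
  by apply/eqP/negP => /negP ne; apply: nex; exists n.
case: (ex_minnP ex) => n ne n_min.
have eq m : m < n -> S m x = S m y.
  by move=> mn; apply/eqP/negP => /negP /n_min; rewrite leqNgt mn.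
move: ne; rewrite neq_ltn => /orP[] lt; [left|right]; exists n; split=> //.
by move=> m /eq.
Qed.

End lexicographic_order.

Lemma measurable_lex d d' (T : measurableType d) (X : measurableType d')
    (S : nat -> X -> nat) (f g : T -> X) :
  (forall n k, measurable [set x | S n x = k]) ->
  measurable_fun setT f -> measurable_fun setT g ->
  measurable [set t | lex_lt S (f t) (g t)].
Proof.
move=> mS mf mg.
have m2 (A : nat -> nat -> Prop) n :
    measurable [set t | A (S n (f t)) (S n (g t))].
  rewrite (_ : mkset _ = [set t | exists i j,
      (S n (f t) = i /\ S n (g t) = j) /\ A i j]).
    apply: measurable_pred_exists => // i; apply: measurable_pred_exists => // j.
    apply: measurable_pred_and; last exact: measurable_pred_cst.
    apply: measurable_pred_and.
    - exact: (measurable_preimageT mf (mS n i)).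
    - exact: (measurable_preimageT mg (mS n j)).
  apply/seteqP; split=> t /=; first by move=> ?; do 2!eexists; split; first by [].
  by move=> [i [j [[-> ->]]]].
apply: measurable_pred_exists => // n; apply: measurable_pred_and.
  apply: measurable_pred_forall => // m; exact: (m2 (fun a b => m < n -> a = b)).
exact: (m2 (fun a b => a < b)).
Qed.

Section order_map.
Variable G : groupType.
Hypothesis G_countable : countable [set: G].
Context d (X : measurableType d) (act : G -> X -> X).
Hypothesis actP : is_action act.
Hypothesis act_measurable : measurable_action act.
Variables (S : nat -> X -> nat) (X0 : set X).
Hypothesis S_measurable : forall n k, measurable [set x | S n x = k].
Hypothesis S_sep : forall x y, (forall n, S n x = S n y) -> x = y.
Hypothesis X0_measurable : measurable X0.
Hypothesis X0_invariant : invariant_set act X0.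
Hypothesis X0_free : forall x g, X0 x -> act g x = x -> g = 1%g.

(** Freeness on [X0] makes distinct group elements give distinct points of the
    orbit, hence comparable ones. *)
Lemma orbit_order_map : exists Phi : X -> borelType (Ord G),
  [/\ measurable_fun setT Phi,
      forall g x, X0 x -> Phi (act g x) = ord_act g (Phi x) &
      forall x g h, X0 x ->
        ord_rel (Phi x) g h <-> lex_lt S (act g^-1%g x) (act h^-1%g x)].
Proof.
pose pat x : {ptws (G * G) -> bool} :=
  fun p => `[< lex_lt S (act p.1^-1%g x) (act p.2^-1%g x) >].
have patP x : X0 x -> pat x \in @strict_total_orders G.
  move=> X0x; rewrite inE; split.
  - by move=> g; apply/negP => /asboolP; exact: lex_irr.
  - by move=> g h k /asboolP gh /asboolP hk; apply/asboolP; exact: lex_trans hk.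
  - move=> g h gh.
    have /(lex_total S_sep) : act g^-1%g x <> act h^-1%g x.
      move=> E; move/eqP: gh; apply.
      have : act (h * g^-1)%g x = x by rewrite (actM actP) E (actVK actP).
      by move=> /(X0_free X0x) hg; rewrite -[LHS]mul1g -hg mulgVK.
    rewrite /pat/=.
    have [gh1|ngh] := asboolP (lex_lt S (act g^-1%g x) (act h^-1%g x));
    have [hg1|nhg] := asboolP (lex_lt S (act h^-1%g x) (act g^-1%g x)) => //.
      by have := lex_irr (lex_trans gh1 hg1).
    by case.
pose Phi x : borelType (Ord G) :=
  if pselect (X0 x) is left H then exist _ (pat x) (patP x H) else point.
have PhiE x g h : X0 x ->
    ord_rel (Phi x) g h <-> lex_lt S (act g^-1%g x) (act h^-1%g x).
  by move=> X0x; rewrite /Phi; case: pselect => //= H; split=> /asboolP.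
exists Phi; split=> //.
- apply: measurable_fun_ord => // g h; rewrite setTI.
  rewrite (_ : mkset _ =
    [set x | X0 x /\ lex_lt S (act g^-1%g x) (act h^-1%g x) \/
      ~ X0 x /\ ord_rel (point : Ord G) g h]).
    apply: measurable_pred_or; apply: measurable_pred_and => //.
    + exact: measurable_lex.
    + exact: measurable_pred_not.
    + exact: measurable_pred_cst.
  apply/seteqP; split=> x /=.
    have [X0x|nX0x] := pselect (X0 x); first by rewrite PhiE//; left.
    by rewrite /Phi; case: pselect => //=; right.
  case=> [[X0x lt]|[nX0x]]; first exact/PhiE.
  by rewrite /Phi; case: pselect.
move=> g x X0x; apply: ord_ext => h k; rewrite ord_actE.
apply/idP/idP.
  rewrite PhiE ?PhiE//; last exact/(invariant_act g x X0_invariant).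
  by rewrite -!(actM actP) !invgM !invgK.
rewrite PhiE ?PhiE//; last exact/(invariant_act g x X0_invariant).
by rewrite -!(actM actP) !invgM !invgK.
Qed.

End order_map.

(** * Sets readable from the order *)

Section readable.
Context d (X : measurableType d) d' (Y : measurableType d').
Variables (X0 : set X) (Phi : X -> Y).

(** The set [A] belongs to the sigma-algebra generated by [Phi], up to points
    outside [X0]. *)
Definition readable (A : X -> Prop) :=
  exists2 C : set Y, measurable C & forall x, X0 x -> A x <-> C (Phi x).

Lemma readable_ext A B : (forall x, X0 x -> A x <-> B x) ->
  readable A -> readable B.
Proof. by move=> AB [C mC CE]; exists C => // x X0x; rewrite -AB// CE. Qed.

Lemma readable_cst (P : Prop) : readable (fun=> P).
Proof. by exists [set y | P]; [exact: measurable_pred_cst|]. Qed.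

Lemma readable_not A : readable A -> readable (fun x => ~ A x).
Proof.
by move=> [C mC CE]; exists (~` C) => [|x X0x]; [exact: measurableC|rewrite CE].
Qed.

Lemma readable_and A B : readable A -> readable B ->
  readable (fun x => A x /\ B x).
Proof.
move=> [C mC CE] [D mD DE]; exists (C `&` D) => [|x X0x]; first exact: measurableI.
by rewrite CE// DE.
Qed.

Lemma readable_exists I (A : I -> X -> Prop) : countable [set: I] ->
  (forall i, readable (A i)) -> readable (fun x => exists i, A i x).
Proof.
move=> cI rA; have {rA} [C mC CE] := all_sig2 (fun i => cid2 (rA i)).
exists [set y | exists i, C i y] => [|x X0x]; first exact: measurable_pred_exists.
by split=> -[i iP]; exists i; exact/(CE i x X0x).
Qed.

End readable.

Section readable_order.
Variable G : groupType.
Hypothesis G_countable : countable [set: G].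
Context d (X : measurableType d) (act : G -> X -> X).
Variables (S : nat -> X -> nat) (X0 : set X) (Phi : X -> borelType (Ord G)).
Hypothesis X0_invariant : invariant_set act X0.
Hypothesis Phi_act : forall g x, X0 x -> Phi (act g x) = ord_act g (Phi x).
Hypothesis PhiE : forall x g h, X0 x ->
  ord_rel (Phi x) g h <-> lex_lt S (act g^-1%g x) (act h^-1%g x).

Lemma readable_act A g : readable X0 Phi A ->
  readable X0 Phi (fun x => A (act g x)).
Proof.
move=> [C mC CE]; exists (ord_act g @^-1` C).
  exact: (measurable_preimageT (measurable_ord_act G_countable g) mC).
by move=> x X0x; rewrite CE ?Phi_act//; apply/(invariant_act g x X0_invariant).
Qed.

Lemma readable_lex g h :
  readable X0 Phi (fun x => lex_lt S (act g x) (act h x)).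
Proof.
exists [set o | ord_rel o g^-1%g h^-1%g]; first exact: measurable_ord_rel.
by move=> x X0x /=; rewrite PhiE// !invgK.
Qed.

End readable_order.

(** * Conull sets, cores and saturations *)

Section conull.
Variables (R : realType) (G : groupType).
Hypothesis G_countable : countable [set: G].
Context d (X : measurableType d) (mu : probability X R) (act : G -> X -> X).
Hypothesis actP : is_action act.
Hypothesis act_measurable : measurable_action act.
Hypothesis act_pmp : invariant_measure mu act.
Hypothesis act_ergodic : ergodic mu act.
Local Open Scope ereal_scope.

Definition conull (A : set X) := measurable A /\ mu (~` A) = 0.

Lemma conull_mu A : conull A -> mu A = 1.
Proof.
move=> [mA mu0]; have := probability_setC mu (measurableC mA).
by rewrite setCK mu0 sube0.
Qed.

Lemma mu1_conull A : measurable A -> mu A = 1 -> conull A.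
Proof. by move=> mA mu1; split=> //; rewrite probability_setC// mu1 subee. Qed.

Lemma conull_forall I (A : I -> set X) : countable [set: I] ->
  (forall i, conull (A i)) -> conull [set x | forall i, A i x].
Proof.
move=> cI cA; have mA : measurable [set x | forall i, A i x].
  by apply: measurable_pred_forall => // i; have [] := cA i.
split=> //; apply/(negligibleP mu (measurableC mA)).
have /countable_injP[f /in2TT f_inj] := cI.
apply: (@negligibleS _ _ _ mu
   (\bigcup_n [set x | exists i, f i = n /\ ~ A i x])).
  by move=> x /= /existsNP[i nAi]; exists (f i) => //; exists i.
apply: negligible_bigcup => n.
have [[i fi]|nex] := pselect (exists i, f i = n).
  have [mAi Ai0] := cA i.
  apply: (@negligibleS _ _ _ mu (~` A i)).
    by move=> x /= [j [fj nAj]]; rewrite (f_inj i j) // fi.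
  by apply/negligibleP => //; exact: measurableC.
apply: (@negligibleS _ _ _ mu set0); last exact: negligible_set0.
by move=> x /= [i [fi _]]; apply: nex; exists i.
Qed.

Lemma conull_and A B : conull A -> conull B -> conull [set x | A x /\ B x].
Proof.
move=> cA cB.
have := @conull_forall bool (fun b => if b then A else B) (countableP _).
rewrite (_ : mkset _ = [set x | A x /\ B x]); first by apply; case.
apply/seteqP; split=> x /= => [H|[Ax Bx] []//].
by split; [exact: (H true)|exact: (H false)].
Qed.

Lemma conull_act g A : conull A -> conull (act g @^-1` A).
Proof.
move=> [mA A0]; split; first exact: (measurable_preimageT (act_measurable g)).
by rewrite -[LHS](act_pmp g (measurableC mA)) in A0.
Qed.

(** The largest invariant subset of [A]. *)
Definition core (A : set X) : set X := [set x | forall g, A (act g x)].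

Lemma core_sub A : core A `<=` A.
Proof. by move=> x /(_ 1%g); rewrite (act1 actP). Qed.

Lemma invariant_core A : invariant_set act (core A).
Proof.
move=> g; apply/seteqP; split=> x /= cx h; last by rewrite -(actM actP).
by have := cx (h * g^-1)%g; rewrite -(actM actP) mulgVK.
Qed.

Lemma conull_core A : conull A -> invariant_conull mu act (core A).
Proof.
move=> cA; have cc : conull (core A).
  by apply: conull_forall => // g; exact: conull_act.
by split; [case: cc|exact: invariant_core|exact: conull_mu].
Qed.

Definition saturation (A : set X) : set X := [set x | exists g, A (act g x)].

Lemma measurable_saturation A : measurable A -> measurable (saturation A).
Proof.
move=> mA; apply: measurable_pred_exists => // g.
exact: (measurable_preimageT (act_measurable g)).
Qed.

Lemma invariant_saturation A : invariant_set act (saturation A).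
Proof.
move=> g; apply/seteqP; split=> x /= [h Ah].
  by exists (h * g)%g; rewrite (actM actP).
by exists (h * g^-1)%g; rewrite -(actM actP) mulgVK.
Qed.

Lemma saturation_sub A : A `<=` saturation A.
Proof. by move=> x Ax; exists 1%g; rewrite (act1 actP). Qed.

Lemma conull_saturation A : measurable A -> 0 < mu A -> conull (saturation A).
Proof.
move=> mA A0; have ms := measurable_saturation mA.
apply: mu1_conull => //.
have [s0|//] := act_ergodic ms (invariant_saturation A).
suff : mu A <= 0 by rewrite leNgt A0.
by rewrite -s0 le_measure ?inE//; exact: saturation_sub.
Qed.

End conull.

(** * Stabilizers of orders *)

Section order_stabilizers.
Variable G : groupType.
Local Open Scope group_scope.

Lemma ord_rel_irr (o : Ord G) x : ~ ord_rel o x x.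
Proof. by have /set_mem[irr _ _] := valP o; apply/negP/irr. Qed.

Lemma ord_rel_trans (o : Ord G) y x z :
  ord_rel o x y -> ord_rel o y z -> ord_rel o x z.
Proof. by have /set_mem[_ tr _] := valP o; apply: tr. Qed.

Lemma ord_rel_total (o : Ord G) x y : x != y -> ord_rel o x y \/ ord_rel o y x.
Proof.
have /set_mem[_ _ tot] := valP o => xy.
have : ord_rel o x y (+) ord_rel o y x by exact: tot.
by case: (ord_rel o x y) => /=; [left|right].
Qed.

(** If [g] is above [1], invariance gives the increasing chain of powers of [g],
    which cannot return to [1]; likewise below. *)
Lemma ord_act_torsion (o : Ord G) g n :
  ord_act g o = o -> g ^+ n.+1 = 1 -> g = 1.
Proof.
move=> go gn; have shift x y : ord_rel o x y -> ord_rel o (g * x) (g * y).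
  by rewrite -{2}go ord_actE !mulKg.
apply/eqP; apply: contrapT => /negP /(ord_rel_total o) [g1|g1].
- have : ord_rel o (g ^+ n.+1) 1.
    elim: (n) => [|k IH]; first by rewrite expg1.
    rewrite expgS; apply: ord_rel_trans (g1).
    by rewrite -[X in ord_rel _ _ X]mulg1; exact: shift.
  by rewrite gn => /ord_rel_irr.
- have : ord_rel o 1 (g ^+ n.+1).
    elim: (n) => [|k IH]; first by rewrite expg1.
    rewrite expgS; apply: (ord_rel_trans g1).
    by rewrite -[X in ord_rel _ X _]mulg1; exact: shift.
  by rewrite gn => /ord_rel_irr.
Qed.

End order_stabilizers.

(** * Separating families and the conull free part *)

Section measurable_digits.
Context d (X : measurableType d) (E : nat -> set X).
Hypothesis E_measurable : forall n, measurable (E n).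
Hypothesis E_sep : forall x y, (forall n, E n x <-> E n y) -> x = y.

Definition digit n x : nat := `[< E n x >].

Lemma measurable_digit n k : measurable [set x | digit n x = k].
Proof.
rewrite (_ : mkset _ = [set x | E n x /\ k = 1 \/ ~ E n x /\ k = 0]).
  apply: measurable_pred_or; apply: measurable_pred_and;
    try exact: measurable_pred_cst; first exact: E_measurable.
  exact/measurable_pred_not/E_measurable.
by apply/seteqP; split=> x /=; rewrite /digit; case: asboolP => Ex /=;
  [left|right|case=> -[]|case=> -[]].
Qed.

Lemma digit_sep x y : (forall n, digit n x = digit n y) -> x = y.
Proof.
move=> xy; apply: E_sep => n; have := xy n; rewrite /digit.
by case: asboolP; case: asboolP.
Qed.

Lemma measurable_fun_eq d' (T : measurableType d') (f g : T -> X) :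
  measurable_fun setT f -> measurable_fun setT g ->
  measurable [set t | f t = g t].
Proof.
move=> mf mg; rewrite (_ : mkset _ = [set t | forall n,
   (E n (f t) /\ E n (g t)) \/ (~ E n (f t) /\ ~ E n (g t))]).
  have mE h n : measurable_fun setT h -> measurable [set t : T | E n (h t)].
    by move=> mh; exact: (measurable_preimageT mh (E_measurable n)).
  apply: measurable_pred_forall => // n.
  apply: measurable_pred_or; apply: measurable_pred_and; try exact: mE;
    apply: measurable_pred_not; exact: mE.
apply/seteqP; split=> t /=.
  by move=> -> n; have [|] := pselect (E n (g t)); [left|right].
by move=> fg; apply: E_sep => n; case: (fg n) => -[].
Qed.

End measurable_digits.

Section atom.
Variables (R : realType) (G : groupType).
Hypothesis G_countable : countable [set: G].
Context d (X : measurableType d) (mu : probability X R) (act : G -> X -> X).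
Hypothesis X_standard : standard_borel R X.
Hypothesis actP : is_action act.
Hypothesis act_measurable : measurable_action act.
Hypothesis act_pmp : invariant_measure mu act.
Hypothesis act_free : essentially_free mu act.
Hypothesis act_ergodic : ergodic mu act.
Local Open Scope ereal_scope.

(** The free part is conull by assumption; the point is that it is measurable. *)
Lemma conull_free : conull mu [set x | forall g, act g x = x -> g = 1%g].
Proof.
have [E [mE Esep _]] := standard_borel_decode X_standard.
set F := mkset _; have mF : measurable F.
  apply: measurable_pred_forall => // g.
  rewrite (_ : mkset _ = [set x | ~ act g x = x \/ g = 1%g]).
    apply: measurable_pred_or; last exact: measurable_pred_cst.
    apply: measurable_pred_not.
    exact: (measurable_fun_eq mE Esep (act_measurable g)
      (@measurable_id _ _ setT)).
  apply/seteqP; split=> x /=; last by case.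
  by move=> H; have [/H|] := pselect (act g x = x); [right|left].
split=> //; apply/(negligibleP mu (measurableC mF)).
apply: (@negligibleS _ _ _ mu _ _ _ act_free) => x /= nFx st.
apply: nFx => g gx; have : stabilizer act x g by [].
by rewrite st.
Qed.

(** * Atomic measures *)

Definition splits := forall A, measurable A -> 0 < mu A ->
  exists A', [/\ measurable A', A' `<=` A, 0 < mu A' & 0 < mu (A `\` A')].

(** An unsplittable set [A] is concentrated, for each set of a countable separating
    family, on that set or on its complement; the intersection of these choices
    has the mass of [A] and contains a single point. *)
Lemma exists_atom : ~ splits -> exists x, measurable [set x] /\ 0 < mu [set x].
Proof.
move=> /existsNP[A /not_implyP[mA /not_implyP[A0 nsplit]]].
have [E [mE Esep _]] := standard_borel_decode X_standard.
have zero A' : measurable A' -> A' `<=` A -> mu A' = 0 \/ mu (A `\` A') = 0.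
  move=> mA' A'A; apply: contrapT => /not_orP[n1 n2]; apply: nsplit; exists A'.
  by split=> //; rewrite lt0e measure_ge0 andbT; apply/eqP.
pose F n := if pselect (mu (A `&` E n) = 0) then ~` E n else E n.
have mF n : measurable (F n).
  by rewrite /F; case: pselect => _ //=; exact: measurableC.
have AF n : mu (A `&` ~` F n) = 0.
  rewrite /F; case: pselect => [//|nz] /=; first by rewrite setCK.
  have [//|] := zero _ (measurableI _ _ mA (mE n)) (@subIsetl _ _ _).
  by rewrite setDE setCI setIUr setICr set0U.
pose K := A `&` [set x | forall n, F n x].
have mK : measurable K.
  by apply: measurableI => //; exact: measurable_pred_forall.
have K0 : 0 < mu K.
  rewrite lt0e measure_ge0 andbT; apply/eqP => K0.
  have /(negligibleP mu mA) : negligible mu A.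
    apply: (@negligibleS _ _ _ mu (K `|` \bigcup_n (A `&` ~` F n))).
      move=> x Ax; have [xF|/existsNP[n nFx]] := pselect (forall n, F n x).
        by left.
      by right; exists n.
    apply: negligibleU; first exact/(negligibleP mu mK).
    apply: negligible_bigcup => n.
    apply/(negligibleP mu (measurableI _ _ mA (measurableC (mF n)))).
    exact: AF.
  by move=> A00; rewrite A00 ltxx in A0.
have [x Kx] : K !=set0.
  by apply/set0P/eqP => KE; rewrite KE measure0 ltxx in K0.
suff KE : K = [set x] by exists x; rewrite -KE.
apply/seteqP; split=> [y Ky|_ ->//]; apply: Esep => n.
move: (Kx.2 n) (Ky.2 n); rewrite /F; case: pselect => _ /= ? ?; by split.
Qed.

(** Otherwise the translates of the atom by powers of [g] are infinitely many
    disjoint sets of equal positive mass. *)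
Lemma atom_torsion x g : measurable [set x] -> 0 < mu [set x] ->
  exists n, act (g ^+ n.+1)%g x = x.
Proof.
move=> mx x0; apply: contrapT => /forallNP nfix.
have orbE h : [set act h x] = act h^-1%g @^-1` [set x].
  apply/seteqP; split => [y ->|y /= <-]; first exact: (actK actP).
  by rewrite (actVK actP).
have morb h : measurable [set act h x].
  by rewrite orbE; exact: (measurable_preimageT (act_measurable _)).
have muorb h : mu [set act h x] = mu [set x] by rewrite orbE act_pmp.
pose F n := [set act (g ^+ n)%g x].
have inj m n : (m < n)%N -> act (g ^+ m)%g x <> act (g ^+ n)%g x.
  move=> mn E; apply: (nfix (n - m).-1); rewrite prednK ?subn_gt0//.
  apply: (can_inj (actK actP (g ^+ m)%g)).
  by rewrite -(actM actP) -expgnDr subnKC// ltnW.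
have tF : trivIset setT F.
  apply/trivIsetP => m n _ _ mn; apply/seteqP; split=> // y [-> E].
  by move: mn; rewrite neq_ltn => /orP[] /inj; [exact|apply; exact: esym].
have le1 n : \sum_(i < n) mu [set x] <= 1.
  rewrite (eq_bigr (fun i : 'I_n => mu (F i))); last by move=> i _; rewrite muorb.
  rewrite -(@measure_bigsetU _ _ _ mu F (fun n => morb _) tF n).
  apply: probability_le1.
  by apply: bigsetU_measurable => i _; exact: morb.
have [c cE] : exists c, mu [set x] = c%:E.
  by exists (fine (mu [set x])); rewrite fineK// fin_num_measure.
have c0 : (0 < c)%R by rewrite -lte_fin -cE.
have := le1 (Num.bound c^-1); rewrite cE sumEFin lee_fin.
rewrite sumr_const card_ord -mulr_natl leNgt => /negP; apply.
by rewrite -ltr_pdivrMr// div1r; apply: archi_boundP; rewrite invr_ge0 ltW.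
Qed.

(** On the orbit of the atom, two points with the same order differ by an element
    that fixes this order and has finite order, hence by the identity. *)
Lemma isomorphism_of_atom x : measurable [set x] -> 0 < mu [set x] ->
  exists nu : probability (borelType (Ord G)) R,
    invariant_measure nu (@ord_act G) /\
    isomorphic_actions mu act nu (@ord_act G).
Proof.
move=> mx x0.
have [E [mE Esep decode]] := standard_borel_decode X_standard.
pose A := [set y | saturation act [set x] y /\ forall g, act g y = y -> g = 1%g].
have cA : conull mu A.
  apply: conull_and; last exact: conull_free.
  exact: (conull_saturation G_countable actP act_measurable act_ergodic).
pose X0 := core act A.
have X0A : X0 `<=` A by exact: core_sub.
have cX0 : invariant_conull mu act X0 by exact: conull_core.
have [mX0 iX0 muX0] := cX0.
have [|Phi [mPhi PhiA PhiE]] := @orbit_order_map _ G_countable _ X act actP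
  act_measurable (digit E) X0 (measurable_digit mE) (digit_sep Esep) mX0 iX0.
  by move=> y g /X0A[_ free]; exact: free.
have Phi_inj y z : X0 y -> X0 z -> Phi y = Phi z -> y = z.
  move=> X0y X0z yz.
  have [[g gy] _] := X0A _ X0y; have [[h hz] freez] := X0A _ X0z.
  pose k := (g^-1 * h)%g.
  have kz : act k z = y by rewrite (actM actP) hz -gy (actK actP).
  suff k1 : k = 1%g by rewrite -kz k1 (act1 actP).
  have zE : [set z] = act h @^-1` [set x].
    apply/seteqP; split=> w /=; first by move=> ->.
    move=> hw.
    by rewrite -(actK actP h w) hw -hz (actK actP).
  have [||n kn] := @atom_torsion z k.
  - by rewrite zE; exact: (measurable_preimageT (act_measurable _)).
  - by rewrite zE act_pmp.
  apply: (@ord_act_torsion _ (Phi z) k n); last exact: freez.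
  by rewrite -PhiA// kz.
have [n|Psi mPsi PsiK] := decode _ (borelType (Ord G)) X0 Phi.
  exists (Phi @` (X0 `&` E n)).
    apply: countable_measurable; first exact: measurable_ord1.
    apply: (@sub_countable _ _ _ [set: G]) => //.
    apply: (@card_le_trans _ _ _ ((fun g => Phi (act g x)) @` setT)).
      apply: subset_card_le => _ [y [/X0A[[g gy] _] _] <-]; exists g^-1%g => //=.
      by rewrite -gy (actK actP).
    exact: card_image_le.
  move=> y X0y; split; first by move=> Ey; exists y.
  by move=> [z [X0z Ez] /(Phi_inj _ _ X0z X0y) <-].
exact: (isomorphism_of_equivariant_retract G_countable act_measurable
  act_pmp cX0 mPhi mPsi PhiA PsiK).
Qed.
End atom.

(** * Readability of blocks *)

Section block_order.
Variable G : groupType.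
Context d (X : measurableType d) (act : G -> X -> X).
Hypothesis actP : is_action act.
Hypothesis act_measurable : measurable_action act.
Variables (g : G) (Q : nat -> set X) (S : nat -> X -> nat).
Hypothesis Q_measurable : forall l, measurable (Q l).
Hypothesis Q_disjoint : forall l l' x, Q l x -> Q l' x -> l = l'.
Hypothesis Q_displaced : forall l l' x, Q l x -> ~ Q l' (act g x).
Hypothesis S_measurable : forall n k, measurable [set x | S n x = k].
Hypothesis S_sep : forall x y, (forall n, S n x = S n y) -> x = y.

(** Block [2 l] is the translate of [Q l] by [g] and block [2 l + 1] is [Q l]. *)
Definition block i : set X :=
  if odd i then Q i./2 else [set x | Q i./2 (act g^-1%g x)].

Lemma block_even l x : block l.*2 x <-> Q l (act g^-1%g x).
Proof. by rewrite /block odd_double doubleK. Qed.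

Lemma block_odd l x : block l.*2.+1 x <-> Q l x.
Proof. by rewrite /block /= odd_double /= uphalf_double. Qed.

Lemma block_shift l x : block l.*2 (act g x) <-> block l.*2.+1 x.
Proof. by rewrite block_even block_odd (actK actP). Qed.

Lemma measurable_block i : measurable (block i).
Proof.
rewrite /block; case: ifP => // _.
exact: (measurable_preimageT (act_measurable _)).
Qed.

Lemma block_uniq i j x : block i x -> block j x -> i = j.
Proof.
rewrite /block => Qi Qj; rewrite -[LHS]odd_double_half -[RHS]odd_double_half.
case: (odd i) Qi; case: (odd j) Qj => /= Qj Qi.
- by rewrite (Q_disjoint Qi Qj).
- by have := Q_displaced Qj; rewrite (actVK actP) => /(_ i./2).
- by have := Q_displaced Qi; rewrite (actVK actP) => /(_ j./2).
- by rewrite (Q_disjoint Qi Qj).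
Qed.

(** The first digit puts the points outside all blocks last; the second sorts the
    others by block; the digits of [S] break ties. *)
Definition block_digit n x : nat :=
  match n with
  | 0 => `[< forall i, ~ block i x >]
  | 1 => first_index (block^~ x)
  | m.+2 => S m x
  end.

Lemma measurable_block_digit n k : measurable [set x | block_digit n x = k].
Proof.
case: n => [|[|n]] /=; last exact: S_measurable.
  have m0 : measurable [set x | forall i, ~ block i x].
    apply: measurable_pred_forall => // i.
    exact/measurable_pred_not/measurable_block.
  exact: (measurable_digit (fun _ => m0) 0 k).
exact: (measurable_first_index (fun i => i = k) measurable_block).
Qed.

Lemma block_digit_sep x y :
  (forall n, block_digit n x = block_digit n y) -> x = y.
Proof. by move=> xy; apply: S_sep => n; exact: (xy n.+2). Qed.

Lemma block_digit0 i x : block i x -> block_digit 0 x = 0.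
Proof. by move=> bi; rewrite /=; case: asboolP => // /(_ i). Qed.

Lemma block_digit1 i x : block i x -> block_digit 1 x = i.
Proof.
by move=> bi; apply: (block_uniq _ bi); exact: (@first_indexP (block^~ x) i bi).
Qed.

Local Notation lt := (lex_lt block_digit).

Lemma block_lt i x y : block i x -> (forall j, block j y -> i < j) -> lt x y.
Proof.
move=> bi y_high; have [[j bj]|ny] := pselect (exists j, block j y).
  exists 1; rewrite (block_digit1 bi) (block_digit1 bj); split; last exact: y_high.
  by case=> // _; rewrite (block_digit0 bi) (block_digit0 bj).
exists 0; split=> //; rewrite (block_digit0 bi) /=; case: asboolP => // -[] j bj.
by apply: ny; exists j.
Qed.

Lemma lt_block j x y : lt x y -> block j y -> exists2 i, i <= j & block i x.
Proof.
move=> xy bj; apply: contrapT => nx; apply: (@lex_irr _ block_digit x).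
apply: lex_trans xy _; apply: (block_lt bj) => i bi.
by rewrite ltnNge; apply/negP => ij; apply: nx; exists i.
Qed.

Variables (X0 : set X) (Phi : X -> borelType (Ord G)).
Hypothesis G_countable : countable [set: G].
Hypothesis X0_invariant : invariant_set act X0.
Hypothesis Phi_act : forall h x, X0 x -> Phi (act h x) = ord_act h (Phi x).
Hypothesis PhiE : forall x h k, X0 x ->
  ord_rel (Phi x) h k <-> lt (act h^-1%g x) (act k^-1%g x).
Hypothesis Q_dichotomy : forall l,
  (forall x, X0 x -> exists h, Q l (act h x)) \/ (forall x, X0 x -> ~ Q l x).

(** A point of [Q l] at or below [x] witnesses that [x] is not in block [2 l]. If
    [x] is in block [2 l], a witness [z] would have to lie in block [2 l] too, and
    so would [act g z], whence [z] would also lie in [Q l], block [2 l + 1]. *)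
Lemma block_evenE l x : (exists h, Q l (act h x)) ->
  let Z y := forall i, i < l.*2 -> ~ block i y in
  block l.*2 x <-> Z x /\ ~ exists h, (~ lt x (act h x) /\ Z (act h x)) /\
    (Z (act g (act h x)) /\ lt (act g (act h x)) (act h x)).
Proof.
move=> hit Z.
have Z_ge y j : Z y -> block j y -> l.*2 <= j.
  by move=> Zy bj; rewrite leqNgt; apply/negP => /Zy.
have Z_block y j : l.*2 <= j -> block j y -> Z y.
  by move=> lj bj i il bi; move: lj; rewrite (block_uniq bj bi) leqNgt il.
split=> [bx|[Zx nex]].
  split; first exact: Z_block bx.
  move=> [h [[]]]; set z := act h x => nlt Zz [Zgz gz_lt].
  have bz : block l.*2 z.
    apply: contrapT => nbz; apply: nlt; apply: (block_lt bx) => j bj.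
    rewrite ltn_neqAle (Z_ge _ _ Zz bj) andbT; apply/eqP => ej; apply: nbz.
    by rewrite ej.
  have [i il bi] := lt_block gz_lt bz.
  have ei : i = l.*2 by apply/eqP; rewrite eqn_leq il (Z_ge _ _ Zgz bi).
  move: bi; rewrite ei block_shift => bz'.
  by have /eqP := block_uniq bz bz'; rewrite ltn_eqF.
apply: contrapT => nbx; apply: nex.
have [h [Qz nlt]] : exists h, Q l (act h x) /\ ~ lt x (act h x).
  (* Another point of [Q l] may lie above [x] when [x] is in [Q l] itself. *)
  have [Qx|nQx] := pselect (Q l x).
    exists 1%g; rewrite (act1 actP); split=> //; exact: lex_irr.
  have [h Qz] := hit; exists h; split=> // x_lt.
  have [i il bi] := lt_block x_lt ((block_odd _ _).2 Qz).
  have := Z_ge _ _ Zx bi; rewrite leq_eqVlt => /orP[/eqP ei|li].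
    by apply: nbx; rewrite ei.
  have ei : i = l.*2.+1 by apply/eqP; rewrite eqn_leq il li.
  by apply: nQx; move: bi; rewrite ei block_odd.
have bz := (block_odd _ _).2 Qz.
have bgz := (block_shift _ _).2 bz.
exists h; split; first by split=> //; exact: Z_block bz.
split; first exact: Z_block bgz.
by apply: (block_lt bgz) => j bj; rewrite (block_uniq bj bz).
Qed.

(** Strong induction on the pairs of blocks. A piece that no orbit in [X0] meets
    is readable because it is empty there; the other pieces fall under
    [block_evenE], and block [2 l + 1] is a translate of block [2 l]. *)
Lemma readable_block i : readable X0 Phi (block i).
Proof.
have ractg := readable_act G_countable X0_invariant Phi_act.
have rlt h k : readable X0 Phi (fun x => lt (act h x) (act k x)).
  exact: (readable_lex PhiE).
suff [rD rQ] : readable X0 Phi (block i./2.*2) /\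
    readable X0 Phi (block i./2.*2.+1).
  by rewrite -(odd_double_half i); case: (odd i).
elim/ltn_ind: (i./2) => l IH.
suff rD : readable X0 Phi (block l.*2).
  split=> //; apply: (readable_ext _ (ractg _ g rD)) => x _.
  exact: block_shift.
have [hit|miss] := Q_dichotomy l; last first.
  apply: (readable_ext _ (readable_cst X0 Phi False)) => x X0x; split=> //.
  move/block_even; apply: miss.
  exact/(invariant_act _ _ X0_invariant).
pose Z y := forall i, i < l.*2 -> ~ block i y.
have rZ : readable X0 Phi Z.
  apply: (readable_ext (A := fun y => ~ exists i, i < l.*2 /\ block i y)).
    move=> x _; split=> [nex j jl bj|Zx [j [jl /(Zx _ jl)]]//].
    by apply: nex; exists j.
  apply: readable_not; apply: readable_exists => // j.
  have [jl|jl] := boolP (j < l.*2); last first.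
    by apply: (readable_ext _ (readable_cst X0 Phi False)) => x _; split=> [|[]].
  have [|rD rQ] := IH j./2; first by rewrite ltn_half_double.
  apply: readable_and; first exact: readable_cst.
  by rewrite -(odd_double_half j); case: (odd j).
apply: (readable_ext (A := fun x => Z x /\ ~ exists h,
    (~ lt (act 1%g x) (act h x) /\ Z (act h x)) /\
    (Z (act (g * h)%g x) /\ lt (act (g * h)%g x) (act h x)))).
  move=> x X0x; rewrite (block_evenE (hit x X0x)).
  rewrite (act1 actP).
  by split=> -[Zx nex]; split=> // -[h Hh]; apply: nex; exists h; move: Hh;
    rewrite (actM actP).
apply: readable_and => //; apply: readable_not; apply: readable_exists => // h.
do !apply: readable_and => //.
- exact: readable_not.
- exact: (ractg Z).
- exact: (ractg Z).
Qed.

End block_order.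

(** * Splitting measures *)

Lemma disjoint_positive_sets (R : realType) d (X : measurableType d)
    (mu : probability X R) (B : set X) :
  splits mu -> measurable B -> (0 < mu B)%E ->
  exists Bs : nat -> set X,
    [/\ forall n, measurable (Bs n), forall n, Bs n `<=` B,
        forall n, (0 < mu (Bs n))%E &
        forall m n x, Bs m x -> Bs n x -> m = n].
Proof.
move=> sp mB B0.
have /choice[h hP] A : exists A', measurable A -> (0 < mu A)%E ->
    [/\ measurable A', A' `<=` A, (0 < mu A')%E & (0 < mu (A `\` A'))%E].
  have [mA|] := pselect (measurable A); last by exists set0.
  have [A0|] := pselect (0 < mu A)%E; last by exists set0.
  by have [A' A'P] := sp A mA A0; exists A'.
pose Rs n := iter n h B.
have RsP n : measurable (Rs n) /\ (0 < mu (Rs n))%E.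
  elim: n => [|n [mR R0]]; first by split.
  by have [] := hP _ mR R0.
have Rs_sub m n : m <= n -> Rs n `<=` Rs m.
  elim: n => [|n IH]; first by rewrite leqn0 => /eqP ->.
  rewrite leq_eqVlt => /orP[/eqP ->//|/IH]; apply: subset_trans.
  by have [mR R0] := RsP n; have [] := hP _ mR R0.
(* Split off one piece at a time, keeping a remainder of positive measure. *)
exists (fun n => Rs n `\` Rs n.+1); split.
- by move=> n; apply: measurableD; [case: (RsP n)|case: (RsP n.+1)].
- by move=> n x [/(@Rs_sub 0 n (leq0n n)) ].
- by move=> n; have [mR R0] := RsP n; have [] := hP _ mR R0.
have le m n x : (Rs m `\` Rs m.+1) x -> (Rs n `\` Rs n.+1) x -> n <= m.
  move=> [_ nm] [Rn _]; rewrite leqNgt; apply/negP => mn; apply: nm.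
  exact: Rs_sub Rn.
move=> m n x xm xn; apply/eqP.
by rewrite eqn_leq (le _ _ _ xm xn) (le _ _ _ xn xm).
Qed.

Section nonatomic.
Variables (R : realType) (G : groupType).
Hypothesis G_countable : countable [set: G].
Context d (X : measurableType d) (mu : probability X R) (act : G -> X -> X).
Hypothesis X_standard : standard_borel R X.
Hypothesis actP : is_action act.
Hypothesis act_measurable : measurable_action act.
Hypothesis act_pmp : invariant_measure mu act.
Hypothesis act_free : essentially_free mu act.
Hypothesis act_ergodic : ergodic mu act.
Hypothesis mu_splits : splits mu.
Local Open Scope ereal_scope.

(** Take [A] whose measure is neither 0 nor 1. If [A] minus its preimage were null
    for every group element, the core of [A] would be an invariant set with the
    measure of [A], against ergodicity. *)
Lemma exists_displaced : exists g B, [/\ measurable B, 0 < mu B &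
  forall x, B x -> ~ B (act g x)].
Proof.
have [|A [mA _ A0 AC0]] := mu_splits (@measurableT _ X).
  by rewrite probability_setT.
apply: contrapT => none.
pose D g := A `&` ~` (act g @^-1` A).
have mD g : measurable (D g).
  apply: measurableI => //; apply: measurableC.
  exact: (measurable_preimageT (act_measurable g)).
have D0 g : mu (D g) = 0.
  apply: contrapT => /eqP nz; apply: none; exists g, (D g); split=> //.
    by rewrite lt0e nz measure_ge0.
  by move=> x [_ nAx] [].
have cA_sub : core act A `<=` A by exact: core_sub.
have mcA : measurable (core act A).
  apply: measurable_pred_forall => // g.
  exact: (measurable_preimageT (act_measurable g)).
have [c0|c1] := act_ergodic mcA (invariant_core actP A).
  have /(negligibleP mu mA) A00 : negligible mu A.
    apply: (@negligibleS _ _ _ mu (core act A `|`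
      ~` [set x | forall g, (~` D g) x])).
      move=> x Ax; have [|/existsNP[g nAg]] := pselect (core act A x).
        by left.
      by right=> /(_ g); apply.
    apply: negligibleU; first exact/(negligibleP mu mcA).
    have [] := @conull_forall _ _ _ mu _ (fun g => ~` D g) G_countable.
      by move=> g; split; [exact: measurableC|rewrite setCK].
    by move=> mF F0; apply/(negligibleP mu (measurableC mF)).
  by rewrite A00 ltxx in A0.
have [_ cA0] := mu1_conull mcA c1.
suff : mu (setT `\` A) <= 0 by rewrite leNgt AC0.
rewrite -cA0 setTD le_measure ?inE//; try exact: measurableC.
exact: subsetC.
Qed.

(** Almost every orbit meets [B], and finitely many group elements suffice outside
    a set of small measure. *)
Lemma saturation_finite (B : set X) (e : nat -> G) (eps : R) :
  (forall g, exists n, e n = g) -> measurable B -> 0 < mu B -> (0 < eps)%R ->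
  exists k, mu (~` [set x | exists j, (j < k)%N /\ B (act (e j) x)]) <= eps%:E.
Proof.
move=> e_surj mB B0 eps0.
pose F k := [set x | exists j, (j < k)%N /\ B (act (e j) x)].
have mF k : measurable (F k).
  apply: measurable_pred_exists => // j; apply: measurable_pred_and.
    exact: measurable_pred_cst.
  exact: (measurable_preimageT (act_measurable _)).
have FU : \bigcup_k F k = saturation act B.
  apply/seteqP; split=> x /=; first by move=> [k _ [j [_ Bj]]]; exists (e j).
  move=> [g Bg]; have [j jg] := e_surj g.
  by exists j.+1 => //; exists j; rewrite jg.
have cF : mu \o F @ \oo --> mu (\bigcup_k F k).
  apply: nondecreasing_cvg_mu => //; first by rewrite FU; exact: measurable_saturation.
  move=> m n mn; rewrite subsetEset => x [j [jm Bj]]; exists j; split=> //.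
  exact: leq_trans mn.
rewrite FU (conull_mu (conull_saturation G_countable actP act_measurable
  act_ergodic mB B0)) in cF.
apply: contrapT => /forallNP big.
have : lim (mu \o F @ \oo) <= (1 - eps)%:E.
  apply: lime_le; first exact: cvgP cF.
  apply: nearW => k /=; rewrite leNgt; apply/negP => lt; apply: (big k).
  rewrite probability_setC; last exact: mF.
  have fF : mu (F k) \is a fin_num by rewrite fin_num_measure.
  move: lt; rewrite -(fineK fF) -EFinB lte_fin lee_fin => lt.
  by rewrite lerBlDr -lerBlDl ltW.
rewrite (cvg_lim _ cF)// lee_fin -subr_ge0 addrAC subrr sub0r oppr_ge0.
by rewrite leNgt eps0.
Qed.

(** The sets [Q l] code the sets [E a]. For each [a] and each precision [b] a
    separate subset of [B] is used. Up to measure [1/(b+1)], every point is moved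
    into it by one of the finitely many group elements [e j], [j < k (a, b)];
    cutting it according to the finite bit string that tells which of the points
    [act (e j)^-1 y] lie in [E a] records membership in [E a] for all these
    points. Letting [b] vary reaches almost every point. A single point thus
    carries finitely many bits, which is why a precision is needed at all. *)
Lemma countable_generator (E : nat -> set X) :
  (forall n, measurable (E n)) ->
  exists g (Q : nat -> set X) (J : nat -> G -> nat -> Prop),
    [/\ forall l, measurable (Q l),
        forall l l' x, Q l x -> Q l' x -> l = l',
        forall l l' x, Q l x -> ~ Q l' (act g x) &
        exists2 C, conull mu C & forall x a, C x ->
          E a x <-> exists h l, J a h l /\ Q l (act h x)].
Proof.
move=> mE.
have [e e_surj] : exists e : nat -> G, forall g, exists n, e n = g.
  have /countable_injP[f /in2TT f_inj] := G_countable.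
  exists (fun n => xget 1%g [set g | f g = n]) => g; exists (f g).
  by case: xgetP => [h _ /f_inj //|/(_ g)/= []//].
have [g [B [mB B0 Bg]]] := exists_displaced.
have [Bs [mBs BsB Bs0 Bs_disj]] := disjoint_positive_sets mu_splits mB B0.
have /choice[k kP] (ab : nat * nat) : exists k, mu (~` [set x | exists j,
    (j < k)%N /\ Bs (pickle ab) (act (e j) x)]) <= ((ab.2.+1%:R)^-1)%:E.
  by apply: saturation_finite => //; rewrite invr_gt0.
(* The index [l] codes [a], [b] and a bit string. *)
pose Qs (c : nat * nat * seq bool) : set X := [set y |
  Bs (pickle c.1) y /\ (size c.2 = k c.1 /\ forall j, (j < k c.1)%N ->
    nth false c.2 j <-> E c.1.1 (act (e j)^-1%g y))].
pose Q l : set X := if pickle_inv l is Some c then Qs c else set0.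
pose J a h l : Prop := exists b s j, [/\ l = pickle (a, b, s : seq bool),
  (j < k (a, b))%N, nth false s j & h = e j].
have mQ l : measurable (Q l).
  rewrite /Q; case: pickle_inv => // c; rewrite /Qs.
  apply: measurable_pred_and; first exact: mBs.
  apply: measurable_pred_and; first exact: measurable_pred_cst.
  apply: measurable_pred_forall => // j.
  have mEj : measurable [set y | E c.1.1 (act (e j)^-1%g y)].
    exact: (measurable_preimageT (act_measurable _)).
  case: (ltnP j (k c.1)) => _; last first.
    by rewrite (_ : mkset _ = setT) //; apply/seteqP; split.
  case: (nth false c.2 j).
    rewrite (_ : mkset _ = [set y | E c.1.1 (act (e j)^-1%g y)])//.
    by apply/seteqP; split=> y /=; [move=> /(_ isT) [H _]; exact: H|].
  rewrite (_ : mkset _ = [set y | ~ E c.1.1 (act (e j)^-1%g y)]).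
    exact: measurable_pred_not.
  apply/seteqP; split=> y /=; first by move=> /(_ isT) [_ H] /H.
  by move=> nEy _; split.
exists g, Q, J; split=> //.
- move=> l l' x; rewrite /Q.
  case El: (pickle_inv l) => [[ab s]|//].
  case El' : (pickle_inv l') => [[ab' s']|//].
  move=> [Bx [ss sE]] [Bx' [ss' sE']].
  have /(pcan_inj pickleK) ab_eq := Bs_disj _ _ _ Bx Bx'.
  simpl in ab_eq; subst ab'.
  have ss_eq : s = s'.
    apply: (@eq_from_nth _ false) => [|j js]; first by rewrite ss ss'.
    rewrite ss in js; apply/idP/idP => [/(sE _ js) /(sE' _ js)//|].
    by move=> /(sE' _ js) /(sE _ js).
  subst s'.
  have invK := @pickle_invK (nat * nat * seq bool)%type.
  by have := invK l; have := invK l'; rewrite El El' /= => <- <-.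
- move=> l l' x; rewrite /Q.
  case: pickle_inv => [c|//]; case: pickle_inv => [c'|_ []].
  by move=> [/BsB /Bg nB _] [/BsB].
pose C := [set x | forall a, exists b j,
    (j < k (a, b))%N /\ Bs (pickle (a, b)) (act (e j) x)].
exists C.
  apply: conull_forall => // a.
  have mF b : measurable [set x | exists j,
      (j < k (a, b))%N /\ Bs (pickle (a, b)) (act (e j) x)].
    apply: measurable_pred_exists => // j; apply: measurable_pred_and.
      exact: measurable_pred_cst.
    exact: (measurable_preimageT (act_measurable _)).
  pose F := [set x | exists b j,
    (j < k (a, b))%N /\ Bs (pickle (a, b)) (act (e j) x)].
  have mFa : measurable F by exact: measurable_pred_exists.
  change (conull mu F).
  split=> //; apply/eqP; rewrite -measure_le0.
  apply/lee_addgt0Pr => eps eps0; rewrite add0e.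
  have [b _ /(_ b (leqnn b)) /= /ltW be] := near_infty_natSinv_lt (PosNum eps0).
  apply: (@le_trans _ _ (b.+1%:R^-1)%:E); last by rewrite lee_fin.
  apply: le_trans (kP (a, b)); rewrite le_measure ?inE//; try exact: measurableC.
  by move=> x nF Fb; apply: nF; exists b.
move=> x a /(_ a) [b [j [jk Bx]]]; split=> [Ex|]; last first.
  move=> [_ [_ [[b' [s [i [-> ik si ->]]]] ]]].
  by rewrite /Q pickleK_inv => -[_ [_ /(_ i ik)[/(_ si)]]]; rewrite /= (actK actP).
pose s := mkseq (fun i => `[< E a (act (e i)^-1%g (act (e j) x)) >]) (k (a, b)).
exists (e j), (pickle (a, b, s)); split.
  exists b, s, j; split=> //; rewrite nth_mkseq//.
  by apply/asboolP; rewrite (actK actP).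
rewrite /Q pickleK_inv; split=> //=; rewrite size_mkseq; split=> // i ik.
by rewrite nth_mkseq//; split=> /asboolP.
Qed.

(** [X0] is an invariant conull set on which the action is free, each [Q l] meets
    all orbits or none, and the coding of the sets [E a] is correct. *)
Lemma isomorphism_of_splits :
  exists nu : probability (borelType (Ord G)) R,
    invariant_measure nu (@ord_act G) /\
    isomorphic_actions mu act nu (@ord_act G).
Proof.
have [E [mE Esep decode]] := standard_borel_decode X_standard.
have [g [Q [J [mQ Q_disj Q_disp [C cC CE]]]]] := countable_generator mE.
pose V l := if pselect (0 < mu (Q l)) then saturation act (Q l) else ~` Q l.
have cV l : conull mu (V l).
  rewrite /V; case: pselect => [Q0|nQ0] /=; first exact: conull_saturation.
  split; first exact: measurableC.
  by rewrite setCK; apply/eqP; rewrite -measure_le0 leNgt; apply/negP.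
pose A := [set x | (forall h, act h x = x -> h = 1%g) /\
  ((forall l, V l x) /\ C x)].
have cA : conull mu A.
  apply: conull_and.
    exact: (conull_free G_countable X_standard act_measurable act_free).
  by apply: conull_and => //; exact: conull_forall.
pose X0 := core act A.
have X0A : X0 `<=` A by exact: core_sub.
have cX0 : invariant_conull mu act X0 by exact: conull_core.
have [mX0 iX0 muX0] := cX0.
pose S := block_digit act g Q (digit E).
have [|Phi [mPhi PhiA PhiE]] := @orbit_order_map _ G_countable _ X act actP
    act_measurable S X0
    (measurable_block_digit act_measurable g mQ (measurable_digit mE))
    (block_digit_sep (digit_sep Esep)) mX0 iX0.
  by move=> y h /X0A[free _]; exact: free.
have Q_dich l : (forall x, X0 x -> exists h, Q l (act h x)) \/
    (forall x, X0 x -> ~ Q l x).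
  have := fun x X0x => (X0A x X0x).2.1 l; rewrite /V.
  by case: pselect => _ /=; [left|right].
have rQ l : readable X0 Phi (Q l).
  apply: (readable_ext _ (readable_block actP Q_disj Q_disp G_countable iX0
    PhiA PhiE Q_dich l.*2.+1)) => x _.
  exact: block_odd.
have [n|Psi mPsi PsiK] := decode _ (borelType (Ord G)) X0 Phi.
  suff : readable X0 Phi (E n) by [].
  apply: (readable_ext (A := fun x => exists h l, J n h l /\ Q l (act h x))).
    by move=> x /X0A[_ [_ Cx]]; rewrite (CE x n Cx).
  apply: readable_exists => // h; apply: readable_exists => // l.
  apply: readable_and; first exact: readable_cst.
  exact: (readable_act G_countable iX0 PhiA h (rQ l)).
exact: (isomorphism_of_equivariant_retract G_countable act_measurable
  act_pmp cX0 mPhi mPsi PhiA PsiK).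
Qed.

End nonatomic.

(** * The isomorphism with an invariant random order *)

Unset Implicit Arguments.

Theorem corollary5p4 (R : realType) (Gamma : groupType)
    (Gamma_countable : countable [set: Gamma])
    (d : measure_display) (X : measurableType d) (mu : probability X R)
    (act : Gamma -> X -> X)
    (X_standard : standard_borel R X)
    (act_action : is_action act)
    (act_measurable : measurable_action act)
    (act_pmp : invariant_measure mu act)
    (act_free : essentially_free mu act)
    (act_ergodic : ergodic mu act) :
  exists nu : probability (borelType (Ord Gamma)) R,
    invariant_measure nu (@ord_act Gamma) /\
    isomorphic_actions mu act nu (@ord_act Gamma).
Proof.
have [sp|nsp] := pselect (splits mu).
  exact: (isomorphism_of_splits Gamma_countable X_standard act_action
    act_measurable act_pmp act_free act_ergodic sp).
have [x [mx x0]] := exists_atom X_standard nsp.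
exact: (isomorphism_of_atom Gamma_countable X_standard act_action
  act_measurable act_pmp act_free act_ergodic mx x0).
Qed.
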